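(* Let $G,H,F$ be graphs and let $\odot$ be an adjacency product. If there exists a surjective domatic homomorphism from $H$ to $F$, then there exists a domatic homomorphism from $G\odot H$ to $G\odot F$, and there exists a domatic homomorphism from $H\odot G$ to $F\odot G$.
   Context: Graphs are finite, simple and nonempty. A domatic homomorphism from $G$ to $H$ is a function $f:V(G)\to V(H)$ such that for every $u'\in V(H)$, every $v'\in N_H(u')$ and every $u\in f^{-1}(u')$, there exists $v\in f^{-1}(v')$ with $uv\in E(G)$ (it need not be a graph homomorphism). An adjacency product $\odot$ assigns to graphs $G,H$ the simple graph $G\odot H$ on $V(G)\times V(H)$ in which $\alpha=(u_a,v_a)$ and $\beta=(u_b,v_b)$ are adjacent iff a condition $P_\odot(G,H,\alpha,\beta)$ holds, where $P_\odot$ is a fixed formula (the same for all $G,H$) built by conjunctions and disjunctions (no negations) from a subset of the four basic formulas $u_a=u_b$, $v_a=v_b$, $u_au_b\in E(G)$, $v_av_b\in E(H)$; since the product is a simple graph, $P_\odot(G,H,\alpha,\alpha)$ never holds. *)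

(* Defs.v *)
From mathcomp Require Import all_boot.

Set Implicit Arguments.
Unset Strict Implicit.
Unset Printing Implicit Defensive.

Record graph := Graph {
  vertex :> finType;
  adj : rel vertex;
  adj_sym : symmetric adj;
  adj_irrefl : irreflexive adj;
  vertex_gt0 : 0 < #|vertex|
}.

Definition neighbors (G : graph) (u : G) : {set G} := [set v | adj u v].

(* [f] is not required to preserve adjacency. *)
Definition domatic_hom (G H : graph) (f : G -> H) : Prop :=
  forall (u' v' : H) (u : G),
    v' \in neighbors u' -> u \in f @^-1: [set u'] ->
    exists2 v : G, v \in f @^-1: [set v'] & adj u v.

Definition surjective (A B : Type) (f : A -> B) : Prop :=
  forall y : B, exists x : A, f x = y.

Inductive adj_formula : Type :=
  | EqL
  | EqR
  | AdjL
  | AdjR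
  | And of adj_formula & adj_formula
  | Or of adj_formula & adj_formula.

Fixpoint holds (P : adj_formula) (G H : graph) (a b : G * H) : bool :=
  match P with
  | EqL => a.1 == b.1
  | EqR => a.2 == b.2
  | AdjL => adj a.1 b.1
  | AdjR => adj a.2 b.2
  | And P1 P2 => holds P1 a b && holds P2 a b
  | Or P1 P2 => holds P1 a b || holds P2 a b
  end.

Record adj_product := AdjProduct {
  formula : adj_formula;
  formula_irrefl :
    forall (G H : graph) (a : G * H), ~~ holds formula a a
}.

Section Product.
Variables (o : adj_product) (G H : graph).

Lemma product_sym : symmetric (@holds (formula o) G H).
Proof.
move=> a b; elim: (formula o) => /= [||||P IP Q IQ|P IP Q IQ].
- exact: eq_sym.
- exact: eq_sym.
- exact: adj_sym.
- exact: adj_sym.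
- by rewrite IP IQ.
- by rewrite IP IQ.
Qed.

Lemma product_irrefl : irreflexive (@holds (formula o) G H).
Proof. by move=> a; apply/negbTE/formula_irrefl. Qed.

Lemma product_gt0 : 0 < #|{: G * H}|.
Proof. by rewrite card_prod muln_gt0 !vertex_gt0. Qed.

Definition product : graph :=
  @Graph (G * H)%type (@holds (formula o) G H)
    product_sym product_irrefl product_gt0.

End Product.

(* Main.v *)
Require Import Defs.
From mathcomp Require Import all_boot.

(** The witnesses are [id * f] and [f * id], where [f] is the given surjective
    domatic homomorphism. Each of them is domatic because an arbitrary vertex
    [d] of [F] lifts to a vertex [z] of [H] that stands to a prescribed [y] at
    least as closely as [d] stands to [f y]: equality and adjacency are both
    preserved ([lift_vertex]). Since the formula of an adjacency product
    contains no negation, preserving the basic formulas is enough to preserve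
    the formula itself ([holds_mono]). Surjectivity matters when [d] is neither
    equal nor adjacent to [f y]: such pairs do contribute edges to a product,
    for instance where the formula only constrains the other factor. *)

(** The two pairs of vertices may live in different products, so this transfers
    edges from the product over [F] to the product over [H]. *)
Lemma holds_mono (P : adj_formula) (G1 H1 G2 H2 : graph)
    (a b : G1 * H1) (c d : G2 * H2) :
  (a.1 == b.1 -> c.1 == d.1) -> (a.2 == b.2 -> c.2 == d.2) ->
  (adj a.1 b.1 -> adj c.1 d.1) -> (adj a.2 b.2 -> adj c.2 d.2) ->
  holds P a b -> holds P c d.
Proof.
move=> eqL eqR adjL adjR; elim: P => //= P IHP Q IHQ.
  by case/andP=> /IHP-> /IHQ->.
by case/orP=> [/IHP->|/IHQ->] //; rewrite orbT.
Qed.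

(** No loops occur in [F], so at most one of the two relations holds between
    [f y] and [d], and a single [z] can be chosen accordingly: [y] itself, a
    neighbour of [y] given by domaticity, or any preimage of [d]. *)
Lemma lift_vertex (H F : graph) (f : H -> F) (y : H) (d : F) :
  domatic_hom f -> surjective f ->
  exists z : H, [/\ f z = d, f y == d -> y == z & adj (f y) d -> adj y z].
Proof.
move=> domf surjf; have [<-|neq_d] := eqVneq (f y) d.
  by exists y; split=> //; rewrite adj_irrefl.
have [adj_d|] := boolP (adj (f y) d); last first.
  by have [z <-] := surjf d; exists z.
have [||z] := domf (f y) d y; rewrite ?inE //.
by move/eqP=> fz adj_yz; exists z.
Qed.

Theorem lemma3 (G H F : graph) (o : adj_product) :
  (exists f : H -> F, domatic_hom f /\ surjective f) ->
  (exists g : product o G H -> product o G F, domatic_hom g) /\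
  (exists g : product o H G -> product o F G, domatic_hom g).
Proof.
case=> f [domf surjf]; split.
  exists (fun p : G * H => (p.1, f p.2)).
  move=> u' [c d] [x y]; rewrite !inE => adj_u' /eqP def_u'.
  move: adj_u'; rewrite -def_u' => adj_cd.
  have [z [fz eq_yz adj_yz]] := lift_vertex _ _ f y d domf surjf.
  exists (c, z); first by rewrite !inE /= fz.
  exact: holds_mono adj_cd.
exists (fun p : H * G => (f p.1, p.2)).
move=> u' [d c] [y x]; rewrite !inE => adj_u' /eqP def_u'.
move: adj_u'; rewrite -def_u' => adj_dc.
have [z [fz eq_yz adj_yz]] := lift_vertex _ _ f y d domf surjf.
exists (z, c); first by rewrite !inE /= fz.
exact: holds_mono adj_dc.
Qed.
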